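(* Let $k\geq\ell\geq0$ be integers with $k\ge1$, and let $m\ge1$ be an integer. Then $$\theta_{(k,\ell),(m)}=\frac{(k+1)!\,\ell!\,m!}{\mathrm{lcm}_{\mathbb{Z}}\bigl([\,k-\ell+1,\ k-\ell+1+\min(\ell,m)\,]\bigr)},$$ where $[a,b]$ denotes the integer interval $\{c\in\mathbb{Z}\mid a\le c\le b\}$ and $\mathrm{lcm}_{\mathbb{Z}}$ of a finite set of positive integers is their positive least common multiple.
   Context: Permutations are composed from right to left. For partitions $\lambda\vdash n$ and $\mu\vdash m$, $\theta_{\lambda,\mu}\in\mathbb{Z}^+$ is the greatest common divisor of the coefficients of $Y_{\mathfrak{t}^\lambda}Y_{(\mathfrak{t}^\mu)^{+n}}Y_{\mathfrak{t}^\lambda\oslash\mathfrak{t}^\mu}\in\mathbb{Z}\mathfrak{S}_{n+m}$, with the following notation. A $\nu$-tableau is a bijective filling of the Young diagram $[\nu]$; $\mathfrak{t}^\nu$ is the $\nu$-tableau with entries $1,2,\dots$ filled in order along successive rows. For a tableau $\mathfrak{s}$ with row stabilizer $R_{\mathfrak{s}}$ and column stabilizer $C_{\mathfrak{s}}$, $Y_{\mathfrak{s}}=\bigl(\sum_{\sigma\in R_{\mathfrak{s}}}\sigma\bigr)\bigl(\sum_{\sigma\in C_{\mathfrak{s}}}\mathrm{sgn}(\sigma)\sigma\bigr)$. For a $\mu$-tableau $\mathfrak{t}$, $\mathfrak{t}^{+n}$ is obtained by adding $n$ to each entry; its stabilizers are subgroups of $\mathfrak{S}_{\{n+1,\dots,n+m\}}\subseteq\mathfrak{S}_{n+m}$.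 For a $\lambda$-tableau $\mathfrak{s}$ and a $\mu$-tableau $\mathfrak{t}$, $\mathfrak{s}\oslash\mathfrak{t}$ is the $(\lambda+\mu)$-tableau obtained by inserting the columns of $\mathfrak{t}^{+n}$ into $\mathfrak{s}$ successively from left to right, each between two adjacent columns of which the left is at least as long and the right strictly shorter (columns of $\mathfrak{s}$ precede columns of $\mathfrak{t}^{+n}$ of the same length, the order within each being kept). Here $\lambda=(k,\ell)$, $n=k+\ell$ and $\mu=(m)$. *)

(* Defs.v *)
From mathcomp Require Import all_boot all_order all_algebra all_fingroup.

Set Implicit Arguments.
Unset Strict Implicit.
Unset Printing Implicit Defensive.

Import GRing.Theory.
Local Open Scope ring_scope.

(* The integral group algebra of 'S_N: an element is its family of            *)
(* coefficients.  The ring structure that MathComp puts on finite functions   *)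
(* is the pointwise one, hence the separate convolution product.              *)
Definition galg (N : nat) := {ffun 'S_N -> int}.

(* Permutations compose from right to left: "u after v" is (v * u)%g, since   *)
(* MathComp has (v * u)%g x = u (v x).                                        *)
Definition galg_mul (N : nat) (f g : galg N) : galg N :=
  [ffun s => \sum_(u : 'S_N) \sum_(v : 'S_N | (v * u)%g == s) f u * g v].

(* A partition is a weakly decreasing sequence of naturals; trailing zeros    *)
(* are allowed and contribute nothing.  A tableau is the sequence of its      *)
(* rows.  Entries start from 0, so that those of a tableau with N boxes can   *)
(* be read in 'I_N: entry i stands for i + 1 in the usual numbering.          *)
Definition tableau := seq (seq nat).

Definition std_tableau (nu : seq nat) : tableau :=
  reshape nu (iota 0 (sumn nu)).

Definition shift_tableau (n : nat) (t : tableau) : tableau :=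
  map (map (addn n)) t.

(* Sends the rows of a tableau to its columns, and its columns to its         *)
(* nonempty rows (the row lengths being weakly decreasing).                   *)
Definition transpose (t : tableau) : seq (seq nat) :=
  mkseq (fun j => [seq nth 0%N r j | r <- t & (j < size r)%N])
        (size (head [::] t)).

(* Permutations preserving each block of B and fixing all other points.       *)
Definition block_stab (N : nat) (B : seq (seq nat)) : {set 'S_N} :=
  [set s : 'S_N | perm_on [set x : 'I_N | val x \in flatten B] s
     && all (fun b => [forall x : 'I_N, (val x \in b) ==> (val (s x) \in b)]) B].

Definition row_stab (N : nat) (t : tableau) : {set 'S_N} := block_stab N t.

Definition col_stab (N : nat) (t : tableau) : {set 'S_N} :=
  block_stab N (transpose t).

Definition row_sum (N : nat) (t : tableau) : galg N :=
  [ffun s : 'S_N => if s \in row_stab N t then 1 else 0].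

Definition signed_col_sum (N : nat) (t : tableau) : galg N :=
  [ffun s : 'S_N => if s \in col_stab N t then (-1) ^+ (s : bool) else 0].

Definition young_symmetrizer (N : nat) (t : tableau) : galg N :=
  galg_mul (row_sum N t) (signed_col_sum N t).

(* cs is ordered by weakly decreasing length, so c lands between the last     *)
(* column at least as long as c and the first strictly shorter one.           *)
Definition insert_col (cs : seq (seq nat)) (c : seq nat) : seq (seq nat) :=
  [seq d <- cs | (size c <= size d)%N] ++ c :: [seq d <- cs | (size d < size c)%N].

Definition oslash (s t : tableau) : tableau :=
  transpose (foldl insert_col (transpose s)
               (transpose (shift_tableau (size (flatten s)) t))).

Definition theta_elt (la mu : seq nat) : galg (sumn la + sumn mu) :=
  let N := (sumn la + sumn mu)%N in
  let tla := std_tableau la in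
  let tmu := std_tableau mu in
  galg_mul
    (galg_mul (young_symmetrizer N tla)
              (young_symmetrizer N (shift_tableau (sumn la) tmu)))
    (young_symmetrizer N (oslash tla tmu)).

Definition theta (la mu : seq nat) : nat :=
  \big[gcdn/0%N]_(s : 'S_(sumn la + sumn mu)) `|theta_elt la mu s|%N.

(* Main.v *)
Require Import Defs.
From mathcomp Require Import all_boot all_order all_algebra all_fingroup.
From mathcomp Require Import ring zify.

(* Let A = {1..k} and B = {k+1..k+l} be the rows of t^la, M the remaining     *)
(* points, C the common signed column sum of t^la and of its insertion with   *)
(* t^mu, and (a_j, b_j) the boxes of the columns of length two.  As           *)
(* S_M S_{A+M} = m! S_{A+M}, the element is m! (S_A S_B C S_{A+M} S_B) C.     *)
(* The coefficient at s of the first factor vanishes if s(B) meets M, and is  *)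
(* (-1)^i l! i! (k-i)! with i = #|s(B) :&: A| otherwise: it is the image under *)
(* the linear form L : X^i |-> (-1)^i l! i! (k-i)! of the product of weights  *)
(* X, 1, 0 of the points of s(B) in A, B, M.  Multiplying by C turns the      *)
(* product over j of the weights of s(b_j) into that of the differences       *)
(* w(s(b_j)) - w(s(a_j)), so each coefficient is 0 or                         *)
(* +- m! L((1-X)^p X^q) with p + q <= l and l - p <= min(l, m).  Since        *)
(* (1-X)^p X^(q+1) = (1-X)^p X^q - (1-X)^(p+1) X^q, the gcd is that of the    *)
(* values for q = 0, which are m! l! (k+1)! / (k-p+1) and are all attained.   *)

(** Write k for [#|A|]. The functional L is an integral in disguise: i! (k-i)! is (k+1)! times the
    Beta integral of t^i (1-t)^(k-i) over [0,1], so for f of degree at most k, L(f) is l! (k+1)!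
    times the integral of (1-t)^k f(-t/(1-t)). The substitution turns 1-X into 1/(1-t), whence
    L((1-X)^p) = l! (k+1)! / (k-p+1); this is where the interval of the theorem comes from
    ([weight_beta], [weight_pow1X]).

    By [young_coefE], every column of length two contributes to a coefficient a factor 0, +-1, +-X
    or +-(1-X). Only a column with a point sent into M can contribute +-1 or +-X, and there are at
    most m such columns. So all coefficients are integral combinations of the m! L((1-X)^p) with l -
    min(l,m) <= p <= l ([pair_weight_prod], [dvd_weight]), and each of these values occurs
    ([pair_weight_attained]). Finally the gcd of the quotients F/d, for divisors d of F, is F
    divided by the lcm of the d; [gcd_pair_weights] applies this to d = k-l+1+t with 0 <= t <=
    min(l,m), and [theta_coefE] carries the result back to tableaux. *)

Set Implicit Arguments.
Unset Strict Implicit.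
Unset Printing Implicit Defensive.

Import GRing.Theory Num.Theory.
Local Open Scope ring_scope.

(** * Counting permutations with prescribed images *)

Section PermutationCounting.
Variable T : finType.
Implicit Types (A B D E U V W : {set T}) (s p q : {perm T}).

Lemma imset_permM s p U : (s * p)%g @: U = p @: (s @: U).
Proof. by rewrite -imset_comp; apply: eq_imset => x; rewrite /= permM. Qed.

Lemma imset_permK s U : s^-1%g @: (s @: U) = U.
Proof. by rewrite -imset_permM mulgV imset_perm1. Qed.

Lemma imset_permKV s U : s @: (s^-1%g @: U) = U.
Proof. by rewrite -imset_permM mulVg imset_perm1. Qed.

Lemma perm_stable_le s U : s @: U \subset U -> s @: U = U.
Proof. by move=> sU; apply/eqP; rewrite eqEcard sU (card_imset _ perm_inj) leqnn. Qed.

Lemma perm_onW U V s : U \subset V -> perm_on U s -> perm_on V s.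
Proof. by move=> sUV sU; apply: subset_trans sUV. Qed.

Lemma perm_on_split U V s : [disjoint U & V] -> perm_on (U :|: V) s ->
  s @: U = U -> exists p q, [/\ perm_on U p, perm_on V q & s = (p * q)%g].
Proof.
move=> dUV sUV sU.
have sN : s \in 'N(U | 'P)%g 
  by apply/astabsP=> x; rewrite -{1}sU /= /aperm mem_imset //; apply: perm_inj.
exists (restr_perm U s), ((restr_perm U s)^-1 * s)%g.
have pU := restr_perm_on U s; split; rewrite ?mulKVg //.
apply/subsetP=> x; rewrite inE permM; apply: contraR => xV.
have [xU|xU] := boolP (x \in U).
  have pxU : (restr_perm U s)^-1%g x \in U by rewrite perm_closed ?perm_onV.
  by rewrite -(restr_permE sN pxU) permKV.
by rewrite (out_perm (perm_onV pU) xU) (out_perm sUV) // inE negb_or xU.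
Qed.

Lemma perm_on_mulE U V p q x : [disjoint U & V] -> perm_on U p ->
  perm_on V q -> (p * q)%g x = if x \in U then p x else q x.
Proof.
move=> dUV pU qV; rewrite permM; case: ifP => xU; last by rewrite (out_perm pU) ?xU.
by rewrite (out_perm qV) // (disjointFr dUV) // perm_closed.
Qed.

(** Factors with disjoint supports can be read off from their product, so multiplication is
    injective on pairs. *)
Lemma card_perm_on_mul U V (P Q : {set {perm T}}) : [disjoint U & V] ->
    {in P, forall p, perm_on U p} -> {in Q, forall q, perm_on V q} ->
  #|(P * Q)%g| = (#|P| * #|Q|)%N.
Proof.
move=> dUV PU QV; rewrite /mulg /= /set_mulg curry_imset2X card_in_imset ?cardsX //.
move=> [p q] [p' q'] /setXP[/= pP qQ] /setXP[/= p'P q'Q] /permP eqpq.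
have E x := esym (perm_on_mulE x dUV (PU p pP) (QV q qQ)).
have E' x := esym (perm_on_mulE x dUV (PU p' p'P) (QV q' q'Q)).
congr (_, _); apply/permP=> x; have := eqpq x; rewrite /= -E -E'; case: ifP => // xU.
- by rewrite (out_perm (PU p pP)) ?(out_perm (PU p' p'P)) ?xU.
- by rewrite (out_perm (QV q qQ)) ?(out_perm (QV q' q'Q)) ?(disjointFr dUV).
Qed.

Lemma perm_onto_exists W U V : U \subset W -> V \subset W -> #|U| = #|V| ->
  exists2 s, perm_on W s & s @: U = V.
Proof.
move Dn: #|U :\: V| => n; elim: n U Dn => [|n IHn] U Dn sUW sVW cUV.
  exists 1%g; rewrite ?perm_on1 ?imset_perm1 //.
  by apply/eqP; rewrite eqEcard cUV leqnn andbT -setD_eq0 -cards_eq0 Dn.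
have /card_gt0P[x] : (0 < #|U :\: V|)%N by rewrite Dn.
have /card_gt0P[y] : (0 < #|V :\: U|)%N.
  rewrite -(ltn_add2l #|V :&: U|) cardsID addn0 -cUV -(cardsID V U).
  by rewrite setIC Dn -addn1 leq_add2l.
rewrite !inE => /andP[yU yV] /andP[xV xU].
have Ut : tperm x y @: U = y |: (U :\ x).
  apply/eqP; rewrite eqEcard (card_imset _ perm_inj) cardsU1 !inE (negPf yU) andbF.
  rewrite (cardsD1 x U) xU leqnn andbT; apply/subsetP=> _ /imsetP[z zU ->].
  rewrite !inE; case: tpermP zU => [_ _|-> yU'|/eqP zx _ zU]; rewrite ?eqxx //.
    by rewrite yU' in yU.
  by rewrite zx zU orbT.
have tW : perm_on W (tperm x y).
  apply: perm_onW (tperm_on x y); rewrite subUset !sub1set.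
  by rewrite (subsetP sUW) ?(subsetP sVW).
have [|||s sW sUV] := IHn (tperm x y @: U) _ _ sVW.
- rewrite Ut setDUl (_ : [set y] :\: V = set0) ?set0U; last first.
    by apply/eqP; rewrite setD_eq0 sub1set.
  move: Dn; rewrite (cardsD1 x) !inE xV xU => -[<-].
  by apply: eq_card => z; rewrite !inE; case: (z \in V); rewrite ?andbF.
- by rewrite -(im_perm_on tW) imsetS.
- by rewrite (card_imset _ perm_inj).
exists (tperm x y * s)%g; first exact: perm_onM.
by rewrite imset_permM.
Qed.

(** These permutations form one coset of the product of the symmetric groups on [U] and
    [W :\: U]. *)
Lemma card_perm_onto W U V : U \subset W -> V \subset W -> #|U| = #|V| ->
  #|[set s | perm_on W s & s @: U == V]| = (#|U|`! * (#|W| - #|U|)`!)%N.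
Proof.
move=> sUW sVW cUV; have [s0 s0W s0U] := perm_onto_exists sUW sVW cUV.
have dU : [disjoint U & W :\: U].
  by rewrite -setI_eq0 setIDA setD_eq0 subsetIl.
have UW : U :|: W :\: U = W by rewrite -{1}(setIidPr sUW) setID.
transitivity #|[set s | perm_on U s] * [set s | perm_on (W :\: U) s]|%g.
  rewrite -(card_imset _ (mulIg s0^-1%g)); apply: eq_card => s.
  apply/imsetP/mulsgP.
    case=> t; rewrite inE => /andP[tW /eqP tU] ->.
    have [||p [q [pU qU eq]]] := @perm_on_split U (W :\: U) (t * s0^-1)%g dU.
    + by rewrite UW perm_onM ?perm_onV.
    + by rewrite imset_permM tU -s0U imset_permK.
    by exists p q; rewrite ?inE.
  case=> p q; rewrite !inE => pU qU ->; exists (p * q * s0)%g; rewrite ?mulgK //.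
  rewrite inE; apply/andP; split.
    rewrite !perm_onM ?(perm_onW sUW pU) ?(perm_onW _ qU) ?subsetDl //.
  rewrite !imset_permM (im_perm_on pU) -s0U.
  rewrite (_ : q @: U = U) //; rewrite -[RHS]imset_id; apply: eq_in_imset => x xU.
  by rewrite (out_perm qU) // (disjointFr dU).
rewrite (card_perm_on_mul dU) => [|p|q]; rewrite ?inE //.
by rewrite !cardsE !card_perm cardsD (setIidPr sUW).
Qed.

(** Such an [s] splits into a permutation of [A] and one of [B], and each part independently carries
    its share of [D] onto that of [E]. *)
Lemma card_perm_onto2 A B D E : [disjoint A & B] ->
    D \subset A :|: B -> E \subset A :|: B ->
    #|A :&: D| = #|A :&: E| -> #|B :&: D| = #|B :&: E| ->
  #|[set s | [&& perm_on (A :|: B) s, s @: A == A & s @: D == E]]| =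
    ((#|A :&: D|`! * (#|A| - #|A :&: D|)`!) *
     (#|B :&: D|`! * (#|B| - #|B :&: D|)`!))%N.
Proof.
move=> dAB sD sE cA cB.
rewrite -(card_perm_onto (subsetIl A D) (subsetIl A E) cA).
rewrite -(card_perm_onto (subsetIl B D) (subsetIl B E) cB).
rewrite -(card_perm_on_mul dAB); last first.
- by move=> q; rewrite inE => /andP[].
- by move=> q; rewrite inE => /andP[].
have split U : U \subset A :|: B -> (A :&: U) :|: (B :&: U) = U.
  by move=> sU; rewrite -setIUl; apply/setIidPr.
have pqA p q U : perm_on A p -> perm_on B q -> (p * q)%g @: (A :&: U) = p @: (A :&: U).
  move=> pA qB; apply: eq_in_imset => x /setIP[xA _].
  by rewrite (perm_on_mulE x dAB pA qB) xA.
have pqB p q U : perm_on A p -> perm_on B q -> (p * q)%g @: (B :&: U) = q @: (B :&: U).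
  move=> pA qB; apply: eq_in_imset => x /setIP[xB _].
  by rewrite (perm_on_mulE x dAB pA qB) (disjointFl dAB).
have imI p U V : perm_on U p -> p @: (U :&: V) = U :&: p @: V.
  by move=> pU; rewrite (imsetI (in2W perm_inj)) (im_perm_on pU).
apply: eq_card => s; apply/idP/mulsgP.
  rewrite inE => /and3P[sAB /eqP sA /eqP sDE].
  have [p [q [pA qB eqs]]] := perm_on_split dAB sAB sA.
  exists p q => //; rewrite inE.
    rewrite pA -(pqA _ q) // -eqs (imsetI (in2W perm_inj)) sA sDE //=.
  rewrite qB -(pqB p q) // -eqs (imsetI (in2W perm_inj)) sDE eqs /=.
  rewrite -(setIidPl (subxx B)) (pqB p q) // setIid (im_perm_on qB) //.
case=> p q; rewrite !inE => /andP[pA /eqP pD] /andP[qB /eqP qD] ->.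
apply/and3P; split.
- by rewrite perm_onM ?(perm_onW _ pA) ?(perm_onW _ qB) ?subsetUl ?subsetUr.
- by have := pqA p q A pA qB; rewrite setIid => ->; rewrite (im_perm_on pA).
- by rewrite -{1}(split D) // imsetU pqA // pqB // pD qD split.
Qed.

End PermutationCounting.

(** * The convolution product *)

Section GroupAlgebra.
Variable N : nat.
Implicit Types (f g h : galg N) (s u v : 'S_N).

Lemma galg_mulE f g s :
  galg_mul f g s = \sum_u f u * g (s * u^-1)%g.
Proof.
rewrite ffunE; apply: eq_bigr => u _.
by rewrite (big_pred1 (s * u^-1)%g) // => v /=; rewrite (can2_eq (mulgK u) (mulgKV u)).
Qed.

Lemma galg_mulEr f g s :
  galg_mul f g s = \sum_v f (v^-1 * s)%g * g v.
Proof.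
rewrite galg_mulE (reindex_inj (inj_comp (mulIg s) invg_inj)) /=.
by apply: eq_bigr => v _; rewrite invMg invgK mulKVg.
Qed.

Lemma galg_mulA f g h :
  galg_mul f (galg_mul g h) = galg_mul (galg_mul f g) h.
Proof.
apply/ffunP=> s; rewrite galg_mulE galg_mulEr.
under eq_bigr do rewrite galg_mulEr mulr_sumr.
rewrite exchange_big /=; apply: eq_bigr => v _.
rewrite galg_mulE mulr_suml; apply: eq_bigr => u _.
by rewrite mulrA mulgA.
Qed.

Definition galg_ind (H : {set 'S_N}) : galg N := [ffun s => if s \in H then 1 else 0].

Lemma galg_mul_ind1 f : galg_mul f (galg_ind [set 1%g]) = f.
Proof.
apply/ffunP=> s; rewrite galg_mulEr (bigD1 1%g) //=.
rewrite [X in _ * X]ffunE inE eqxx mulr1 invg1 mul1g.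
by rewrite big1 ?addr0 // => u u1; rewrite [X in _ * X]ffunE inE (negPf u1) mulr0.
Qed.

Lemma galg_ind_mulE (H : {set 'S_N}) f s :
  galg_mul (galg_ind H) f s = \sum_(u in H) f (s * u^-1)%g.
Proof.
rewrite galg_mulE [RHS]big_mkcond; apply: eq_bigr => u _.
by rewrite ffunE; case: ifP; rewrite ?mul1r ?mul0r.
Qed.

(** All [#|H|] terms of the convolution coincide. This is the source of the factor m!, with [H] the
    symmetric group on the points of the added row. *)
Lemma galg_mul_subgroup (H K : {set 'S_N}) :
    {in H, forall u s, ((s * u^-1)%g \in K) = (s \in K)} ->
  galg_mul (galg_ind H) (galg_ind K) = [ffun s => #|H|%:R * galg_ind K s].
Proof.
move=> HK; apply/ffunP=> s; rewrite galg_ind_mulE ffunE.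
rewrite (eq_bigr (fun=> galg_ind K s)) => [|u uH]; last by rewrite !ffunE HK.
by rewrite sumr_const mulr_natl.
Qed.

Lemma galg_mulZr (c : int) f g :
  galg_mul f [ffun s => c * g s] = [ffun s => c * galg_mul f g s].
Proof.
apply/ffunP=> s; rewrite [RHS]ffunE !galg_mulE mulr_sumr.
by apply: eq_bigr => u _; rewrite ffunE mulrCA.
Qed.

Lemma galg_mulZl (c : int) f g :
  galg_mul [ffun s => c * f s] g = [ffun s => c * galg_mul f g s].
Proof.
apply/ffunP=> s; rewrite [RHS]ffunE !galg_mulE mulr_sumr.
by apply: eq_bigr => u _; rewrite ffunE mulrA.
Qed.

End GroupAlgebra.

(** * The coefficients and their gcd, for abstract rows and columns *)

Section TwoRowSymmetrizer.
Variables (N l : nat) (A B : {set 'I_N}) (a b : 'I_l -> 'I_N).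
Hypotheses (aI : injective a) (bI : injective b).
Hypotheses (aA : forall j, a j \in A) (defB : B = [set b j | j : 'I_l]).
Hypotheses (dAB : [disjoint A & B]).

Let bB j : b j \in B. Proof. by rewrite defB imset_f. Qed.

Let inB x : x \in B -> exists j, x = b j.
Proof. by rewrite defB => /imsetP[j _ ->]; exists j. Qed.

Let ab_neq i j : (a i == b j) = false.
Proof. by apply: contraTF (bB j) => /eqP <-; rewrite (disjointFr dAB). Qed.

Let ba_neq i j : (b i == a j) = false. Proof. by rewrite eq_sym ab_neq. Qed.

Let cardB : #|B| = l. Proof. by rewrite defB card_imset // card_ord. Qed.

Let leqlA : (l <= #|A|)%N.
Proof.
rewrite -[X in (X <= _)%N](card_ord l) -(card_imset predT aI); apply/subset_leq_card.
by apply/subsetP=> _ /imsetP[j _ ->].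
Qed.

Let abP x : [\/ exists j, x = a j, exists j, x = b j |
              forall j, (a j != x) && (b j != x)].
Proof.
have [[j /eqP->]|xa] := altP (@existsP _ (fun j => x == a j)).
  by constructor 1; exists j.
have [[j /eqP->]|xb] := altP (@existsP _ (fun j => x == b j)).
  by constructor 2; exists j.
constructor 3 => j; rewrite ![_ == x]eq_sym.
by move/existsPn: xa => ->; move/existsPn: xb => ->.
Qed.

(** * The column stabilizer, parametrized by sets of columns *)

Definition col_swaps (J : {set 'I_l}) : 'S_N :=
  (\prod_(j <- enum J) tperm (a j) (b j))%g.

Lemma col_swapsE J j :
  (col_swaps J (a j) = if j \in J then b j else a j) *
  (col_swaps J (b j) = if j \in J then a j else b j).
Proof.
rewrite /col_swaps -(mem_enum J j); elim: (enum J) (enum_uniq J) j => [|i js IHjs] /=.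
  by move=> _ j; rewrite big_nil !perm1.
case/andP=> ijs /IHjs{}IHjs j; rewrite big_cons !permM inE.
have [->|ji] := eqVneq j i; first by rewrite tpermL tpermR !IHjs (negPf ijs).
by rewrite !tpermD ?IHjs // ?(inj_eq aI) ?(inj_eq bI) ?ab_neq ?ba_neq // eq_sym.
Qed.

Lemma col_swaps_out J x : (forall j, (a j != x) && (b j != x)) -> col_swaps J x = x.
Proof.
move=> xab; rewrite /col_swaps; elim: (enum J) => [|i js IHjs]; first by rewrite big_nil perm1.
by rewrite big_cons permM tpermD ?IHjs //; case/andP: (xab i).
Qed.

Lemma odd_col_swaps J : odd_perm (col_swaps J) = odd #|J|.
Proof.
rewrite /col_swaps cardE; elim: (enum J) => [|i js IHjs]; first by rewrite big_nil odd_perm1.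
by rewrite big_cons odd_mul_tperm ab_neq IHjs.
Qed.

Lemma col_swapsV J : (col_swaps J)^-1%g = col_swaps J.
Proof.
apply/permP=> x; apply: (canLR (permK _)).
have [[j ->]|[j ->]|xab] := abP x; rewrite ?col_swapsE ?(col_swaps_out _ xab) //.
  by case: ifP => jJ; rewrite col_swapsE jJ.
by case: ifP => jJ; rewrite col_swapsE jJ.
Qed.

Definition same_col x y :=
  (y == x) || [exists j, (x == a j) && (y == b j) || (x == b j) && (y == a j)].

Lemma same_colP x y : reflect
  (y = x \/ exists j, (x = a j /\ y = b j) \/ (x = b j /\ y = a j)) (same_col x y).
Proof.
apply: (iffP orP) => [[/eqP|/existsP[j /orP[]/andP[/eqP-> /eqP->]]]|]; [by left| | |].
- by right; exists j; left.
- by right; exists j; right.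
case=> [->|[j [[-> ->]|[-> ->]]]]; [by left | |].
  by right; apply/existsP; exists j; rewrite !eqxx.
by right; apply/existsP; exists j; rewrite !eqxx orbT.
Qed.

Definition column_group : {set 'S_N} := [set s : 'S_N | [forall x, same_col x (s x)]].

Definition column_sum : galg N :=
  [ffun s : 'S_N => if s \in column_group then (-1) ^+ (s : bool) else 0].

Lemma column_groupE (s : 'S_N) : s \in column_group ->
  col_swaps [set j | s (a j) == b j] = s.
Proof.
rewrite inE => /forallP sC; apply/permP=> x.
have [[j ->]|[j ->]|xab] := abP x; rewrite ?col_swapsE ?inE.
- case: eqP => [-> //|sa]; case/same_colP: (sC (a j)) => [-> //|[i []]].
    by case=> /aI<- /sa.
  by case=> /eqP; rewrite ab_neq.
- case/same_colP: (sC (b j)) => [sb|[i []]]; last 1 first.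
  + case=> /bI<- sb; rewrite sb; case/same_colP: (sC (a j)) => [sa|[i' []]].
    * by have /eqP := perm_inj (etrans sa (esym sb)); rewrite ab_neq.
    * by case=> /aI<- ->; rewrite eqxx.
    * by case=> /eqP; rewrite ab_neq.
  + by rewrite sb -[X in _ == X]sb (inj_eq perm_inj) ab_neq.
  by case=> /eqP; rewrite ba_neq.
rewrite col_swaps_out //; case/same_colP: (sC x) => [-> //|[i [][xi _]]];
  by have:= xab i; rewrite -xi eqxx ?andbF.
Qed.

Lemma col_swaps_in J : col_swaps J \in column_group.
Proof.
rewrite inE; apply/forallP=> x; apply/same_colP.
have [[j ->]|[j ->]|xab] := abP x; rewrite ?col_swapsE ?(col_swaps_out _ xab) //.
- by case: ifP => _; [right; exists j; left | left].
- by case: ifP => _; [right; exists j; right | left].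
- by left.
Qed.

(** An element of the column stabilizer is determined by the set [J] of columns that it swaps, and
    its sign is the parity of [#|J|]. *)
Lemma sum_column_group (F : 'S_N -> int) :
  \sum_s column_sum s * F s = \sum_(J : {set 'I_l}) (-1) ^+ #|J| * F (col_swaps J).
Proof.
rewrite (bigID (mem column_group)) /= addrC big1 ?add0r => [|s sC]; last first.
  by rewrite ffunE (negPf sC) mul0r.
rewrite (reindex_onto col_swaps (fun s => [set j | s (a j) == b j])) /=; last first.
  exact: column_groupE.
apply: eq_big => [J|J _]; last by rewrite ffunE col_swaps_in odd_col_swaps signr_odd.
rewrite col_swaps_in /=; apply/eqP/setP=> j; rewrite inE col_swapsE.
by case: ifP; rewrite ?eqxx ?ab_neq.
Qed.

(** * The weight functional and the coefficients *)

Definition point_weight (x : 'I_N) : {poly int} :=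
  if x \in A then 'X else if x \in B then 1 else 0.

Definition orbit_weight (i : nat) : int :=
  (-1) ^+ i * (i`! * (#|A| - i)`! * l`!)%N%:R.

(** The functional L. Cutting the sum at degree [#|A|] loses nothing for the polynomials arising as
    coefficients, which are products of [l] factors of degree at most one, with [l <= #|A|]. *)
Definition weight (p : {poly int}) : int :=
  \sum_(i < #|A|.+1) p`_i * orbit_weight i.

Lemma weightX i : (i <= #|A|)%N -> weight 'X^i = orbit_weight i.
Proof.
move=> leiA; rewrite /weight (bigD1 (inord i)) //= inordK // coefXn eqxx mul1r.
rewrite big1 ?addr0 // => j; rewrite coefXn -val_eqE /= inordK // => /negPf ->.
by rewrite mul0r.
Qed.

Lemma weightB p q : weight (p - q) = weight p - weight q.
Proof. by rewrite /weight -sumrB; apply: eq_bigr => i _; rewrite coefB mulrBl. Qed.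

Lemma weight0 : weight 0 = 0.
Proof. by rewrite -[X in weight X](subrr 0) weightB subrr. Qed.

Lemma weightN p : weight (- p) = - weight p.
Proof. by rewrite -sub0r weightB weight0 sub0r. Qed.

Lemma weight_sum (I : finType) (F : I -> {poly int}) :
  weight (\sum_i F i) = \sum_i weight (F i).
Proof.
rewrite /weight exchange_big; apply: eq_bigr => i _.
by rewrite coef_sum mulr_suml.
Qed.

Lemma weightMsign n p : weight ((-1) ^+ n * p) = (-1) ^+ n * weight p.
Proof.
by rewrite -signr_odd -[in RHS]signr_odd; case: odd; rewrite !(mul1r, mulN1r) ?weightN.
Qed.

Definition row_group : {set 'S_N} := [set s | perm_on (A :|: B) s & s @: A == A].
(** The rows of the insertion tableau are the complement of [B] and, if nonempty, [B] itself, so its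
    row stabilizer is the setwise stabilizer of [B] in the full symmetric group. *)
Definition setstab : {set 'S_N} := [set s : 'S_N | s @: B == B].

Let colB J := [set col_swaps J x | x in B].

Let colB_sub J : colB J \subset A :|: B.
Proof.
apply/subsetP=> _ /imsetP[_ /inB[j ->] ->].
by rewrite col_swapsE; case: ifP; rewrite inE ?aA ?bB ?orbT.
Qed.

Let cardAcolB J : #|A :&: colB J| = #|J|.
Proof.
rewrite -(card_imset _ aI); apply: eq_card => x; apply/setIP/imsetP.
  case=> xA /imsetP[_ /inB[j ->]]; rewrite col_swapsE.
  case: ifP => jJ xE; first by exists j.
  by rewrite xE (disjointFl dAB) in xA.
case=> j jJ ->; split=> //; apply/imsetP; exists (b j) => //.
by rewrite col_swapsE jJ.
Qed.

Let cardI_AB (D : {set 'I_N}) : D \subset A :|: B -> #|D| = l ->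
  #|B :&: D| = (l - #|A :&: D|)%N.
Proof.
move=> sD <-; rewrite -(cardsID A D) [D :&: A]setIC addKn.
apply: eq_card => x; rewrite !inE; case xD: (x \in D); rewrite ?andbF ?andbT //.
have := subsetP sD x xD; rewrite inE; case xA: (x \in A) => //=.
by rewrite (disjointFr dAB).
Qed.

(** The orbits of [row_group] on the [l]-subsets of [A :|: B] are classified by the size of the
    intersection with [A], and this size is [#|J|] for [colB J]. *)
Lemma count_row_group J (E : {set 'I_N}) : E \subset A :|: B -> #|E| = l ->
  #|[set u in row_group | u @: colB J == E]| =
    if #|J| == #|A :&: E| then
      ((#|J|`! * (#|A| - #|J|)`!) * ((l - #|J|)`! * #|J|`!))%N else 0%N.
Proof.
move=> sE cE; have cD : #|colB J| = l by rewrite card_imset //; apply: perm_inj.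
have leJ : (#|J| <= l)%N by rewrite -[X in (_ <= X)%N]card_ord max_card.
case: eqP => [eJ|neJ].
  rewrite -(cardAcolB J) in eJ *.
  have eqB : #|B :&: colB J| = #|B :&: E| by rewrite !cardI_AB // eJ.
  rewrite -[RHS]/(_ * _)%N; have := card_perm_onto2 dAB (colB_sub J) sE eJ eqB.
  rewrite cardI_AB // cardB subKn ?cardAcolB // => <-.
  by apply: eq_card => u; rewrite !inE andbA.
apply/eqP; rewrite cards_eq0 -subset0; apply/subsetP=> u; rewrite !inE.
case/andP=> /andP[_ /eqP uA] /eqP uD; case: neJ; rewrite -(cardAcolB J).
by rewrite -uD -{2}uA -imsetI ?card_imset //; [apply: perm_inj | apply: in2W perm_inj].
Qed.

(** If s is u after c after w with w preserving [B], then s(B) = u(c(B)). Hence the coefficient is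
    the signed number of pairs (u, c) with u(c(B)) = s(B). The weights X, 1, 0 are chosen so that
    their product is X^i with i the size of the part of s(B) in [A], or 0 when s(B) leaves
    [A :|: B]. *)
Lemma row_col_setstabE s :
  galg_mul (galg_ind row_group) (galg_mul column_sum (galg_ind setstab)) s =
  weight (\prod_j point_weight (s (b j))).
Proof.
pose E := s @: B.
transitivity (\sum_(J : {set 'I_l})
    (-1) ^+ #|J| * #|[set u in row_group | u @: colB J == E]|%:R : int).
  rewrite galg_ind_mulE; under eq_bigr do rewrite galg_mulE sum_column_group.
  rewrite exchange_big /=; apply: eq_bigr => J _; rewrite -mulr_sumr; congr (_ * _).
  rewrite -sum1_card natr_sum big_mkcond [RHS]big_mkcond; apply: eq_bigr => u _.
  rewrite !inE !ffunE inE !imset_permM; case: ifP => //= _.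
  rewrite (_ : (_ == B) = (u @: colB J == E)) //; apply/eqP/eqP.
    by move=> eB; rewrite /E -(imset_permKV u (s @: B))
       -(imset_permKV (col_swaps J) (u^-1%g @: (s @: B))) eB.
  by rewrite -/E => <-; rewrite !imset_permK.
have cE : #|E| = l by rewrite card_imset //; apply: perm_inj.
have [sE|] := boolP (E \subset A :|: B); last first.
  case/subsetPn=> _ /imsetP[_ /inB[j ->] ->] sbN.
  rewrite (bigD1 j) //= /point_weight; move: (sbN); rewrite inE => /norP[/negPf-> /negPf->].
  rewrite mul0r weight0 big1 // => J _.
  rewrite (_ : [set u in _ | _] = set0) ?cards0 ?mulr0 //.
  apply/eqP; rewrite -subset0; apply/subsetP=> u; rewrite !inE => /andP[/andP[uAB _] /eqP uE].
  case/negP: sbN; have : s (b j) \in E by apply/imset_f.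
  rewrite -uE -[in X in _ -> X](im_perm_on uAB) => /imsetP[z zD ->].
  by apply/imset_f/(subsetP (colB_sub J)).
have leA : (#|A :&: E| <= l)%N by rewrite -[X in (_ <= X)%N]cE subset_leq_card ?subsetIr.
have -> : \prod_j point_weight (s (b j)) = 'X^(#|A :&: E|).
  rewrite (eq_bigr (fun j => 'X^(s (b j) \in A))) => [|j _]; last first.
    have : s (b j) \in A :|: B by rewrite (subsetP sE) ?imset_f.
    rewrite /point_weight inE; case: ifP => //= _ ->; first by rewrite expr0.
  rewrite prodrXr; congr ('X^ _).
  have -> : (\sum_j (s (b j) \in A) = #|[set j | s (b j) \in A]|)%N.
    by rewrite -sum1dep_card [RHS]big_mkcond; apply: eq_bigr => j _; case: (s (b j) \in A).
  rewrite -(card_imset _ (inj_comp (@perm_inj _ s) bI)).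
  apply: eq_card => x; apply/imsetP/setIP.
    by case=> j /[!inE] jA ->; split; last exact: imset_f (bB j).
  case=> xA /imsetP[_ /inB[j ->] xE]; exists j => //.
  by rewrite inE -xE.
rewrite weightX ?(leq_trans leA) //.
under eq_bigr do rewrite count_row_group //.
set i := #|A :&: E|.
rewrite (bigID (mem [set J : {set 'I_l} | #|J| == i])) /= addrC big1 ?add0r; last first.
  by move=> J; rewrite inE => /negPf->; rewrite mulr0.
(* [c] is the contribution of each [J] of size [i]; the binomial number of such [J] turns
   [(l - i)! * i!] into [l!]. *)
pose c : int := (-1) ^+ i * ((i`! * (#|A| - i)`!) * ((l - i)`! * i`!))%N%:R.
rewrite (eq_bigr (fun=> c)) => [|J]; last by rewrite inE => /eqP ->; rewrite eqxx.
rewrite sumr_const card_draws card_ord /c /orbit_weight -mulrnAr -mulrnA.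
congr (_ * (_)%N%:R); rewrite -(bin_fact leA) -/i; ring.
Qed.

Lemma young_coefE s :
  galg_mul (galg_mul (galg_ind row_group) (galg_mul column_sum (galg_ind setstab)))
     column_sum s =
  weight (\prod_j (point_weight (s (b j)) - point_weight (s (a j)))).
Proof.
rewrite galg_mulEr (eq_bigr _ (fun v _ => mulrC _ _)) sum_column_group.
(* With the negative summand placed first, the set [J] produced by [bigA_distr] is exactly the set
   of swapped columns. *)
rewrite (eq_bigr (fun j => - point_weight (s (a j)) + point_weight (s (b j)))); last first.
  by move=> j _; rewrite addrC.
rewrite bigA_distr weight_sum; apply: eq_bigr => J _.
rewrite row_col_setstabE col_swapsV -weightMsign; congr weight.
rewrite -prodr_const big_mkcond -big_split /=; apply: eq_bigr => j _.
by rewrite permM col_swapsE; case: ifP; rewrite ?mulN1r ?mul1r.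
Qed.

(** This is the Beta integral of t^q (1-t)^(k-p-q), k being [#|A|], with denominators cleared; the
    sign comes from X becoming -t/(1-t). The induction on [p] replaces the integral by the identity
    (1-X)^(p+1) X^q = (1-X)^p X^q - (1-X)^p X^(q+1). *)
Lemma weight_beta p q : (p + q <= #|A|)%N ->
  weight ((1 - 'X) ^+ p * 'X^q) * (#|A| - p).+1`!%:R =
  (-1) ^+ q * ((#|A|.+1)`! * q`! * (#|A| - q - p)`! * l`!)%N%:R.
Proof.
elim: p q => [|p IHp] q lepq.
  rewrite expr0 mul1r subn0 subn0 weightX // /orbit_weight -mulrA -natrM.
  by congr (_ * _%:R); ring.
have e : weight ((1 - 'X) ^+ p.+1 * 'X^q) =
    weight ((1 - 'X) ^+ p * 'X^q) - weight ((1 - 'X) ^+ p * 'X^(q.+1)).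
  by rewrite -weightB; congr weight; rewrite !exprS; ring.
(* Multiplying through by k-p+1 raises the factorial (k-p)! of the goal to the one in the induction
   hypothesis. *)
have c0 : ((#|A| - p).+1%:R : int) != 0 by rewrite pnatr_eq0.
apply: (mulfI c0); rewrite subnS prednK; last by lia.
rewrite mulrCA -natrM -factS e mulrBl IHp; last by lia.
rewrite IHp; last by lia.
have -> : (#|A| - q - p = (#|A| - q - p.+1).+1)%N by lia.
have -> : (#|A| - q.+1 - p = #|A| - q - p.+1)%N by lia.
have -> : ((#|A| - p).+1 = (#|A| - q - p.+1).+1 + q.+1)%N by lia.
rewrite !factS exprS !natrM !natrD; ring.
Qed.

Lemma weight_pow1X p : (p <= #|A|)%N ->
  weight ((1 - 'X) ^+ p) * (#|A| - p).+1%:R = ((#|A|.+1)`! * l`!)%N%:R.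
Proof.
move=> lepA; have := @weight_beta p 0; rewrite addn0 expr0 mulr1 subn0 mul1r => /(_ lepA).
have c0 : ((#|A| - p)`!%:R : int) != 0 by rewrite pnatr_eq0 -lt0n fact_gt0.
move=> e; apply: (mulIf c0); rewrite -mulrA -natrM -factS e -natrM.
by congr _%:R; rewrite fact0; ring.
Qed.

(** Writing X = 1 - (1-X) removes the powers of X one at a time; each removal lowers [q] and raises
    [p] by at most one, so both bounds persist. *)
Lemma dvd_weight (d : int) (m : nat) :
    (forall p, (p <= l)%N -> (l - p <= m)%N -> (d %| weight ((1 - 'X) ^+ p))%Z) ->
  forall p q, (p + q <= l)%N -> (l - p <= m)%N -> (d %| weight ((1 - 'X) ^+ p * 'X^q))%Z.
Proof.
move=> dP p q; elim: q p => [|q IHq] p lepq lem.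
  by rewrite expr0 mulr1 dP //; lia.
have -> : (1 - 'X) ^+ p * 'X^(q.+1) =
    (1 - 'X) ^+ p * 'X^q - (1 - 'X) ^+ p.+1 * 'X^q :> {poly int}.
  by rewrite !exprS; ring.
by rewrite weightB rpredB // IHq //; lia.
Qed.

(** * Columns that meet the points outside both rows *)

Let outside : {set 'I_N} := ~: (A :|: B).

Lemma pair_weight_prod (s : 'S_N) (js : seq 'I_l) :
    \prod_(j <- js) (point_weight (s (b j)) - point_weight (s (a j))) = 0 \/
  exists e p q, [/\ \prod_(j <- js) (point_weight (s (b j)) - point_weight (s (a j)))
      = (-1) ^+ e * ((1 - 'X) ^+ p * 'X^q), (p + q <= size js)%N &
    (size js - p <=
      count (fun j => (s (a j) \in outside) || (s (b j) \in outside)) js)%N].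
Proof.
elim: js => [|j js]; first by right; exists 0, 0, 0; rewrite big_nil !expr0 !mulr1.
rewrite big_cons => -[->|[e [p [q [-> lepq lec]]]]]; first by left; rewrite mulr0.
rewrite /point_weight /= !inE !negb_or.
(* [step] prepends a column: [p'] and [q'] are the exponents in its factor, [c] its contribution to
   the count. A column with nonzero factor adds to the exponent of 1-X or meets the outside. *)
have step e' p' q' (f : {poly int}) (c : nat) :
    f = (-1) ^+ e' * ((1 - 'X) ^+ p' * 'X^q') ->
    (p' + q' <= 1)%N -> (1 <= p' + c)%N ->
  exists e0 p0 q0, [/\ f * ((-1) ^+ e * ((1 - 'X) ^+ p * 'X^q))
      = (-1) ^+ e0 * ((1 - 'X) ^+ p0 * 'X^q0), (p0 + q0 <= (size js).+1)%N &
    ((size js).+1 - p0 <= c +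
      count (fun j => (s (a j) \in outside) || (s (b j) \in outside)) js)%N].
  move=> -> ? ?; exists (e' + e)%N, (p' + p)%N, (q' + q)%N; split; [|lia|lia].
  by rewrite !exprD; ring.
case: (s (b j) \in A); case: (s (a j) \in A) => //=.
- by left; rewrite subrr mul0r.
- case: (s (a j) \in B) => /=; right.
  + by apply: (step 1 1 0)%N => //; rewrite expr0; ring.
  + by apply: (step 0 0 1)%N => //; ring.
- case: (s (b j) \in B) => /=; right.
  + by apply: (step 0 1 0)%N => //; rewrite !expr0; ring.
  + by apply: (step 1 0 1)%N => //; ring.
case: (s (b j) \in B); case: (s (a j) \in B) => /=.
- by left; rewrite subrr mul0r.
- by right; apply: (step 0 0 0)%N => //; rewrite !expr0; ring.
- by right; apply: (step 1 0 0)%N => //; rewrite !expr0; ring.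
- by left; rewrite subrr mul0r.
Qed.

(** Columns are disjoint, so choosing in each such column a point sent outside gives an injection
    into [outside]. *)
Lemma card_pairs_outside (s : 'S_N) :
  (#|[set j | (s (a j) \in outside) || (s (b j) \in outside)]| <= #|outside|)%N.
Proof.
pose h j := if s (a j) \in outside then s (a j) else s (b j).
rewrite -(@card_imset _ _ h) => [|i j]; last first.
  rewrite /h; do 2!case: ifP => _; move/perm_inj.
  - exact: aI.
  - by move/eqP; rewrite ab_neq.
  - by move/eqP; rewrite ba_neq.
  - exact: bI.
apply/subset_leq_card/subsetP=> _ /imsetP[j + ->]; rewrite inE /h.
by case: ifP.
Qed.

Lemma dvd_pair_weight (d : int) (s : 'S_N) :
    (forall p, (p <= l)%N -> (l - p <= #|outside|)%N -> (d %| weight ((1 - 'X) ^+ p))%Z) ->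
  (d %| weight (\prod_j (point_weight (s (b j)) - point_weight (s (a j)))))%Z.
Proof.
move=> dP; rewrite -big_enum /=; set js := enum _.
have [->|[e [p [q [-> lepq lec]]]]] := pair_weight_prod s js.
  by rewrite weight0 dvdz0.
rewrite weightMsign; apply: dvdz_mull; rewrite -cardE card_ord in lepq lec.
apply: (dvd_weight dP lepq); apply: leq_trans lec _.
by apply: leq_trans (card_pairs_outside s); rewrite -sum1dep_card -sum1_count big_enum_cond.
Qed.

(** The witness sends the first [t] of the points [a j] outside and moves nothing but these and
    points of [outside]. Those [t] columns contribute 1 - 0, the remaining ones 1 - X. *)
Lemma pair_weight_attained t : (t <= l)%N -> (t <= #|outside|)%N ->
  exists s : 'S_N,
    \prod_j (point_weight (s (b j)) - point_weight (s (a j))) = (1 - 'X) ^+ (l - t).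
Proof.
move=> letl letm; pose U := [set a j | j in [set j : 'I_l | (j < t)%N]].
pose V := [set x in take t (enum outside)].
have sV x : x \in V -> x \in outside by rewrite inE => /mem_take; rewrite mem_enum.
have cU : #|[set j : 'I_l | (j < t)%N]| = t.
  rewrite -sum1dep_card.
  by rewrite (big_ord_narrow letl) sum1_card card_ord.
have cV : #|V| = t.
  rewrite cardsE (card_uniqP _) ?take_uniq ?enum_uniq // size_takel //.
  by rewrite -cardE.
have [||| s sW sUV] := @perm_onto_exists _ (U :|: outside) U V.
- exact: subsetUl.
- by apply/subsetP=> x /sV xM; rewrite inE xM orbT.
- by rewrite card_imset // cU cV.
exists s; rewrite (bigID (fun j : 'I_l => (j < t)%N)) /= big1 ?mul1r => [|j jt]; last first.
  have : s (a j) \in V by rewrite -sUV !imset_f // inE.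
  move/sV; rewrite !inE => /norP[/negPf sA /negPf sB].
  rewrite (out_perm sW) ?inE; last first.
    rewrite bB orbT /= orbF; apply/imsetP=> -[i _ /eqP]; by rewrite ba_neq.
  by rewrite /point_weight bB (disjointFl dAB) // sA sB subr0.
rewrite (eq_bigr (fun=> 1 - 'X)) => [|j jt]; last first.
  rewrite !(out_perm sW) ?inE ?aA ?bB ?orbT /= ?orbF.
  + by rewrite /point_weight aA bB (disjointFl dAB).
  + by apply/imsetP=> -[i /[!inE] it /aI ji]; rewrite ji it in jt.
  + by apply/imsetP=> -[i _ /eqP]; rewrite ba_neq.
rewrite prodr_const; congr (_ ^+ _).
transitivity #|~: [set j : 'I_l | (j < t)%N]|; first by apply: eq_card => j; rewrite !inE.
by rewrite cardsCs setCK card_ord cU.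
Qed.

Lemma gcd_pair_weights c :
  (\big[gcdn/0%N]_(s : 'S_N)
     `|(c%:R * weight (\prod_j (point_weight (s (b j)) - point_weight (s (a j)))))%R| *
   \big[lcmn/1%N]_(#|A| - l + 1 <= i < (#|A| - l + 1 + minn l #|outside|).+1) i =
   (#|A| + 1)`! * l`! * c)%N.
Proof.
case: c => [|c]; first by rewrite muln0 big1 ?mul0n // => s _; rewrite mul0r.
set L := \big[lcmn/1%N]_(_ <= i < _) i; set G := \big[gcdn/0%N]_s _.
set F := ((#|A| + 1)`! * l`!)%N.
have F0 : (0 < F)%N by rewrite muln_gt0 !fact_gt0.
have wF t : (t <= l)%N -> (`|weight ((1 - 'X)%R ^+ (l - t))%R| * (#|A| - l + 1 + t) = F)%N.
  move=> letl; have := @weight_pow1X (l - t) (leq_trans (leq_subr _ _) leqlA).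
  have -> : ((#|A| - (l - t)).+1 = #|A| - l + 1 + t)%N by have := leqlA; lia.
  rewrite -[#|A|.+1]addn1 -/F.
  by move/(congr1 absz); rewrite abszM !natz.
have rng i : i \in index_iota (#|A| - l + 1) (#|A| - l + 1 + minn l #|outside|).+1 ->
    exists t, [/\ i = #|A| - l + 1 + t, t <= l & t <= #|outside|]%N.
  rewrite mem_index_iota => /andP[lei]; rewrite ltnS -leq_subLR leq_min => /andP[? ?].
  by exists (i - (#|A| - l + 1))%N; rewrite subnKC.
have dvL t : (t <= l)%N -> (t <= #|outside|)%N -> (#|A| - l + 1 + t %| L)%N.
  move=> letl letm; rewrite /L (big_rem (#|A| - l + 1 + t)%N) /= ?dvdn_lcml //.
  by rewrite mem_index_iota leq_addr ltnS leq_add2l leq_min letl.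
have LF : (L %| F)%N.
  rewrite /L big_seq; elim/big_ind: _ => [|x y|i /rng[t [-> letl _]]]; first exact: dvd1n.
    by rewrite dvdn_lcm => -> ->.
  by rewrite -(wF t letl) dvdn_mull.
have GcF t : (t <= l)%N -> (t <= #|outside|)%N -> (G * (#|A| - l + 1 + t) %| F * c.+1)%N.
  move=> letl letm; rewrite -(wF t letl) mulnAC dvdn_pmul2r; last by rewrite addn1.
  have [s ws] := pair_weight_attained letl letm.
  by apply: (biggcdn_inf s) => //; rewrite ws abszM mulnC natz.
have GF : (G %| F * c.+1)%N by apply: dvdn_trans (GcF 0%N _ _); rewrite ?dvdn_mulr.
have G0 : (0 < G)%N by apply: dvdn_gt0 GF; rewrite muln_gt0 F0.
(* Each k-l+1+t divides the quotient of [F * c.+1] by [G], hence so does their lcm. *)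
have GLF : (G * L %| F * c.+1)%N.
  rewrite -(divnK GF) mulnC dvdn_pmul2r // /L big_seq.
  elim/big_ind: _ => [|x y|i /rng[t [-> letl letm]]]; first exact: dvd1n.
    by rewrite dvdn_lcm => -> ->.
  by rewrite -(dvdn_pmul2r G0) divnK // mulnC GcF.
have L0 : (0 < L)%N by apply: dvdn_gt0 LF.
(* For the converse it suffices that [F %/ L] times [c.+1] divide every coefficient, and [F %/ L]
   divides each quotient of [F] by k-l+1+t. *)
apply/eqP; rewrite eqn_dvd GLF /= -(divnK LF) mulnAC dvdn_pmul2r //.
apply/dvdn_biggcdP=> s _; rewrite abszM mulnC natz dvdn_pmul2l //.
rewrite -[X in (X %| _)%N]absz_nat -dvdzE; apply: dvd_pair_weight => p lepl lepm.
have := wF (l - p)%N (leq_subr _ _); rewrite subKn // => wp.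
have /dvdnP[e eL] := dvL (l - p)%N (leq_subr _ _) lepm.
rewrite dvdzE absz_nat; apply/dvdnP; exists e.
have c0 : (0 < #|A| - l + 1 + (l - p))%N by rewrite addn1.
by apply/eqP; rewrite -(eqn_pmul2r c0) wp mulnAC -eL mulnC divnK.
Qed.

(** * Pointwise forms of the stabilizers *)

Lemma same_colL j y : same_col (a j) y = (y \in [:: a j; b j]).
Proof.
apply/same_colP/idP; rewrite !inE.
  by case=> [->|[i [[/aI-> ->]|[/eqP + _]]]]; rewrite ?eqxx ?orbT // ab_neq.
by case/orP=> /eqP->; [left | right; exists j; left].
Qed.

Lemma same_colR j y : same_col (b j) y = (y \in [:: a j; b j]).
Proof.
apply/same_colP/idP; rewrite !inE.
  by case=> [->|[i [[/eqP + _]|[/bI-> ->]]]]; rewrite ?eqxx ?orbT // ba_neq.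
by case/orP=> /eqP->; [right; exists j; right | left].
Qed.

Lemma same_col_out x y : (forall j, (a j != x) && (b j != x)) -> same_col x y = (y == x).
Proof.
move=> xab; apply/same_colP/eqP => [[//|[j [][xj _]]]|]; last by left.
  by have := xab j; rewrite xj eqxx.
by have := xab j; rewrite xj eqxx andbF.
Qed.

Lemma row_groupE : row_group =
  [set s : 'S_N | [forall x, if x \in A then s x \in A else
     if x \in B then s x \in B else s x == x]].
Proof.
apply/setP=> s; rewrite !inE; apply/andP/forallP => [[sAB /eqP sA] x|sx].
  have [xA|xA] := boolP (x \in A); first by rewrite -sA imset_f.
  have sxA : s x \notin A by rewrite -sA mem_imset //; apply: perm_inj.
  have := perm_closed x sAB; rewrite !inE (negPf xA) (negPf sxA) /= => xB.
  by case: ifP xB => // xB _; rewrite (out_perm sAB) // inE (negPf xA) xB.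
split; last first.
  apply/eqP/perm_stable_le/subsetP=> _ /imsetP[x xA ->].
  by have := sx x; rewrite xA.
apply/subsetP=> x; rewrite !inE; apply: contraR; rewrite negb_or => /andP[xA xB].
by have := sx x; rewrite (negPf xA) (negPf xB).
Qed.

Lemma setstabE : setstab =
  [set s : 'S_N | [forall x, if x \in B then s x \in B else s x \notin B]].
Proof.
apply/setP=> s; rewrite !inE; apply/eqP/forallP => [sB x|sx].
  have -> : (s x \in B) = (x \in B) by rewrite -{1}sB mem_imset //; apply: perm_inj.
  by case: (x \in B).
apply: perm_stable_le; apply/subsetP=> _ /imsetP[x xB ->].
by have := sx x; rewrite xB.
Qed.

End TwoRowSymmetrizer.

(** * Tableaux with rows of lengths (k, l) and (m) *)

Section Tableaux.
Implicit Types (k l m n : nat).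

Lemma std_tableau_row m : std_tableau [:: m] = [:: iota 0 m].
Proof. by rewrite /std_tableau /= addn0 take_oversize // size_iota. Qed.

Lemma std_tableau_two_rows k l : std_tableau [:: k; l] = [:: iota 0 k; iota k l].
Proof.
by rewrite /std_tableau /= addn0 take_iota drop_iota take_iota addKn minnn
  (minn_idPl (leq_addr _ _)).
Qed.

Lemma shift_tableau_row n m : shift_tableau n [:: iota 0 m] = [:: iota n m].
Proof. by rewrite /shift_tableau /= -iotaDl addn0. Qed.

Lemma transpose_row (r : seq nat) : transpose [:: r] = [seq [:: i] | i <- r].
Proof.
rewrite /transpose /= -[in RHS](mkseq_nth 0%N r) /mkseq -map_comp.
by apply/eq_in_map => j; rewrite mem_iota /= => ->.
Qed.

(** The tail [r] is empty for the tableau of (k,l) and is the added row for the insertion, so one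
    computation serves both column stabilizers. *)
Lemma transpose_two_rows k l (r : seq nat) : (l <= k)%N ->
  transpose [:: iota 0 k ++ r; iota k l] =
    [seq [:: j; (k + j)%N] | j <- iota 0 l] ++
    [seq [:: i] | i <- iota l (k - l)] ++ [seq [:: i] | i <- r].
Proof.
move=> lelk; rewrite -map_cat.
have -> : iota l (k - l) ++ r =
    [seq nth 0%N (iota 0 k ++ r) j | j <- iota l (k - l + size r)].
  rewrite -[LHS](mkseq_nth 0%N) size_cat size_iota /mkseq.
  rewrite -[X in _ = map _ (iota X _)]addn0 iotaDl -map_comp.
  apply: eq_map => j /=; rewrite -[in RHS](subnKC lelk) iotaD add0n -catA [RHS]nth_cat size_iota.
  by rewrite ltnNge leq_addr /= addKn.
rewrite /transpose /mkseq /= size_cat size_iota -map_comp.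
rewrite (_ : k + size r = l + (k - l + size r))%N; last by rewrite addnA subnKC.
rewrite iotaD map_cat add0n; congr (_ ++ _); apply/eq_in_map => j; rewrite mem_iota.
  move=> /= ltjl; have ltjk := leq_trans ltjl lelk.
  by rewrite !size_iota ltn_addr //= ltjl /= nth_cat size_iota ltjk !nth_iota.
by case/andP=> lelj ->; rewrite size_iota [(j < l)%N]ltnNge lelj.
Qed.

(** Every column present is at least as long as a singleton, so each insertion lands at the end. *)
Lemma insert_singletons (cs : seq (seq nat)) (r : seq nat) :
    all (fun c => 0 < size c)%N cs ->
  foldl insert_col cs [seq [:: i] | i <- r] = cs ++ [seq [:: i] | i <- r].
Proof.
elim: r cs => [|i r IHr] cs cs0 /=; first by rewrite cats0.
have -> : insert_col cs [:: i] = rcons cs [:: i].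
  rewrite /insert_col /= -cats1 (all_filterP _) //; congr (_ ++ _ :: _).
  apply/eqP; rewrite -size_eq0 size_filter -leqn0 leqNgt -has_count.
  by apply/hasPn=> c /(allP cs0); rewrite -leqNgt.
by rewrite IHr ?cat_rcons // all_rcons.
Qed.

(** [transpose] reads the number of rows off the first column, which has length one exactly when [l]
    is 0; the empty second row then disappears. *)
Lemma transpose_columns k l (r : seq nat) : (l <= k)%N -> (0 < k)%N ->
  transpose ([seq [:: j; (k + j)%N] | j <- iota 0 l] ++
    [seq [:: i] | i <- iota l (k - l)] ++ [seq [:: i] | i <- r]) =
  if l is 0 then [:: iota 0 k ++ r] else [:: iota 0 k ++ r; iota k l].
Proof.
move=> lelk k0; rewrite -map_cat.
set C := _ ++ _.
have row0 : [seq nth 0%N c 0 | c <- C & (0 < size c)%N] = iota 0 k ++ r.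
  rewrite (all_filterP _); last by rewrite all_cat !all_map; apply/andP; split; apply/allP.
  rewrite map_cat -!map_comp map_id_in // map_id_in // catA.
  by rewrite -[X in iota X (k - l)]add0n -iotaD subnKC.
have row1 : [seq nth 0%N c 1 | c <- C & (1 < size c)%N] = iota k l.
  rewrite filter_cat !filter_map (eq_filter (a2 := xpredT)) // filter_predT.
  rewrite (eq_filter (a2 := xpred0)) // filter_pred0 /= cats0 -map_comp.
  by rewrite -[in RHS](addn0 k) iotaDl.
have sC : size (head [::] C) = if l is 0 then 1%N else 2.
  by rewrite /C; case: (l) lelk => [|l'] //=; case: (k) k0.
rewrite /transpose sC; case: (l) row1 => [|l'] row1; rewrite /mkseq /=.
  by rewrite row0.
by rewrite row0 row1.
Qed.

Lemma oslash_row k l m : (l <= k)%N -> (0 < k)%N ->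
  oslash [:: iota 0 k; iota k l] [:: iota 0 m] =
  if l is 0 then [:: iota 0 k ++ iota (k + l) m]
  else [:: iota 0 k ++ iota (k + l) m; iota k l].
Proof.
move=> lelk k0; rewrite /oslash shift_tableau_row [flatten _]/= cats0 size_cat !size_iota.
have := transpose_two_rows [::] lelk; rewrite cats0 => ->.
rewrite transpose_row insert_singletons.
  by rewrite /= cats0 -catA transpose_columns.
by rewrite cats0 all_cat !all_map; apply/andP; split; apply/allP.
Qed.

End Tableaux.

(** The relation [e] means lying in the same block, and becomes equality off the blocks. Both
    requirements on [s] then merge into one condition on each pair of [x] and [s x], a form shared
    by row and column stabilizers. *)
Lemma block_stabE (N : nat) (Bs : seq (seq nat)) (e : rel 'I_N) :
    (forall c (x y : 'I_N), c \in Bs -> val x \in c -> e x y = (val y \in c)) ->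
    (forall x y : 'I_N, val x \notin flatten Bs -> e x y = (y == x)) ->
  block_stab N Bs = [set s : 'S_N | [forall x, e x (s x)]].
Proof.
move=> eBs eout; apply/setP=> s; rewrite !inE.
apply/andP/forallP => [[sB /allP sBs] x|es].
  have [/flattenP[c cBs xc]|xN] := boolP (val x \in flatten Bs).
    by rewrite (eBs c) //; have /forallP/(_ x)/implyP := sBs c cBs; apply.
  by rewrite eout // (out_perm sB) // inE.
split.
  by apply/subsetP=> x; rewrite !inE; apply: contraR => /eout <-.
apply/allP=> c cBs; apply/forallP=> x; apply/implyP=> xc.
by rewrite -(eBs c x).
Qed.

Lemma block_stab1 (N : nat) (c : seq nat) :
  block_stab N [:: c] = [set s : 'S_N | perm_on [set x : 'I_N | val x \in c] s].
Proof.
apply/setP=> s; rewrite !inE /= cats0 andbT.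
apply/andP/idP => [[] //|sc]; split=> //; apply/forallP=> x; apply/implyP=> xc.
by have := perm_closed x sc; rewrite !inE xc.
Qed.

(** * Identification of the stabilizers and of the coefficients of theta *)

Section TwoRowsAndOneRow.
Variables (N k l m : nat).
Hypotheses (lelk : (l <= k)%N) (k0 : (0 < k)%N) (eN : N = (k + l + m)%N).

Let A : {set 'I_N} := [set x : 'I_N | (x < k)%N].
Let B : {set 'I_N} := [set x : 'I_N | (k <= x < k + l)%N].

Let ltaN (j : 'I_l) : (j < N)%N. Proof. by rewrite eN; have := ltn_ord j; lia. Qed.
Let ltbN (j : 'I_l) : (k + j < N)%N. Proof. by rewrite eN; have := ltn_ord j; lia. Qed.
Let a (j : 'I_l) : 'I_N := Ordinal (ltaN j).
Let b (j : 'I_l) : 'I_N := Ordinal (ltbN j).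

Let aI : injective a. Proof. by move=> i j /(congr1 val) /= /val_inj. Qed.
Let bI : injective b. Proof. by move=> i j /(congr1 val) /= /addnI /val_inj. Qed.

Let aA j : a j \in A.
Proof. by rewrite inE /= (leq_trans (ltn_ord j)). Qed.

Let defB : B = [set b j | j : 'I_l].
Proof.
apply/setP=> x; rewrite inE; apply/idP/imsetP => [/andP[lekx ltx]|[j _ ->]] /=.
  have ltxl : (x - k < l)%N by lia.
  by exists (Ordinal ltxl) => //; apply/val_inj; rewrite /= subnKC.
by rewrite leq_addr ltn_add2l ltn_ord.
Qed.

Let dAB : [disjoint A & B].
Proof. by rewrite -setI_eq0; apply/eqP/setP=> x; rewrite !inE; lia. Qed.

Let card_lt n : (n <= N)%N -> #|[set x : 'I_N | (x < n)%N]| = n.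
Proof. by move=> lenN; rewrite -sum1dep_card (big_ord_narrow lenN) sum1_card card_ord. Qed.

Let cardA : #|A| = k. Proof. by apply: card_lt; lia. Qed.

Let card_outside : #|~: (A :|: B)| = m.
Proof.
have -> : A :|: B = [set x : 'I_N | (x < k + l)%N] by apply/setP=> x; rewrite !inE; lia.
by rewrite cardsCs setCK card_ord card_lt; lia.
Qed.

Let tla := [:: iota 0 k; iota k l].

Lemma row_stab_la : row_stab N tla = row_group A B.
Proof.
rewrite row_groupE //; apply: (block_stabE (e := fun x y =>
  if x \in A then y \in A else if x \in B then y \in B else y == x)) => [c x y|x y];
  rewrite !inE.
  case/orP=> /eqP->; rewrite !mem_iota /= => xc; first by rewrite ifT //; lia.
  by case/andP: xc => kx ->; rewrite ltnNge kx.
by rewrite /= cats0 mem_cat !mem_iota /= => xN; rewrite !ifF //; lia.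
Qed.

Lemma row_stab_oslash : row_stab N (oslash tla [:: iota 0 m]) = setstab B.
Proof.
rewrite setstabE oslash_row //.
have lt_x (x : 'I_N) : (x < k + l + m)%N by rewrite -eN.
have r0E (x : 'I_N) : (val x \in iota 0 k ++ iota (k + l) m) = (x \notin B).
  by have := lt_x x; rewrite mem_cat !mem_iota inE /=; lia.
have r1E (x : 'I_N) : (val x \in iota k l) = (x \in B) by rewrite mem_iota inE.
apply: (block_stabE (e := fun x y => if x \in B then y \in B else y \notin B)) => [c x y|x y].
  (* For [l] equal to 0 the insertion has a single row and [B] is empty. *)
  case: (l) r0E r1E => [|l'] r0E r1E; rewrite /= !in_cons in_nil ?orbF; first move/eqP->.
    by rewrite !r0E => /negPf->.
  case/orP=> /eqP->; first by rewrite !r0E => /negPf->.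
  by rewrite !r1E => ->.
have [xB|xB] := boolP (x \in B); last first.
  by case: (l) r0E => [|l'] r0E; rewrite /= mem_cat r0E xB.
case: (l) r1E => [|l'] r1E; last first.
  by case/flattenP; exists (iota k l'.+1); rewrite ?r1E // !in_cons eqxx orbT.
by move: xB; rewrite -r1E.
Qed.

(** Columns of length one only impose fixed points, and the bound on [r] keeps the added ones apart
    from the boxes [a j] and [b j]. Inserting them therefore leaves the stabilizer unchanged. *)
Lemma col_stab_columns (t : tableau) (r : seq nat) :
    transpose t = [seq [:: j; (k + j)%N] | j <- iota 0 l] ++
      [seq [:: i] | i <- iota l (k - l)] ++ [seq [:: i] | i <- r] ->
    all (leq (k + l)) r ->
  col_stab N t = column_group a b.
Proof.
move=> et /allP r_ge; rewrite /col_stab et -map_cat.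
have out (x y : 'I_N) : val x \in iota l (k - l) ++ r -> same_col a b x y = (y == x).
  move=> xr; apply: same_col_out => j.
  rewrite -!val_eqE; move: xr; rewrite mem_cat mem_iota /= => xr.
  by have := ltn_ord j; case/orP: xr => [|/r_ge]; [lia|lia].
apply: block_stabE => [c x y|x y].
  rewrite mem_cat => /orP[] /mapP[i].
    rewrite mem_iota add0n => /andP[_ lti] ->.
    rewrite -[i]/(val (Ordinal lti)); set j := Ordinal lti.
    rewrite -[val j]/(val (a j)) -[(k + _)%N]/(val (b j)) !inE !val_eqE.
    case/orP=> /eqP->.
      by rewrite (same_colL aI aA defB dAB) !inE.
    by rewrite (same_colR bI aA defB dAB) !inE.
  by move=> ir ->; rewrite !inE => /eqP xi; rewrite out ?xi // -xi.
rewrite flatten_cat mem_cat negb_or => /andP[x1 x2]; apply: same_col_out => j.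
have jC : [:: val j; (k + j)%N] \in [seq [:: i; (k + i)%N] | i <- iota 0 l].
  by apply/mapP; exists (val j); rewrite // mem_iota /=.
by apply/andP; split; apply: contraNneq x1 => <-; apply/flattenP;
  exists [:: val j; (k + j)%N]; rewrite // !inE eqxx ?orbT.
Qed.

Lemma col_sum_la : signed_col_sum N tla = column_sum a b.
Proof.
rewrite /signed_col_sum /column_sum (@col_stab_columns _ [::]) //.
by rewrite -transpose_two_rows // cats0.
Qed.

Lemma col_sum_oslash : signed_col_sum N (oslash tla [:: iota 0 m]) = column_sum a b.
Proof.
rewrite /signed_col_sum /column_sum (@col_stab_columns _ (iota (k + l) m)) //; last first.
  by apply/allP=> i; rewrite mem_iota => /andP[].
rewrite -transpose_two_rows // oslash_row //.
by case: (l).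
Qed.

(** All columns are singletons, so the signed column sum is the identity and only the row sum
    remains. *)
Lemma young_row : young_symmetrizer N [:: iota (k + l) m] =
  galg_ind [set s : 'S_N | perm_on (~: (A :|: B)) s].
Proof.
rewrite /young_symmetrizer.
have -> : signed_col_sum N [:: iota (k + l) m] = galg_ind [set 1%g].
  apply/ffunP=> s; rewrite !ffunE /col_stab transpose_row.
  rewrite (@block_stabE _ _ (fun x y => y == x)) => [|c x y /mapP[i _ ->]|//]; last first.
    by rewrite !inE => /eqP <-; rewrite val_eqE.
  rewrite !inE; have [->|s1] := eqVneq s 1%g.
    by rewrite odd_perm1 expr0; case: forallP => // -[] x; rewrite perm1.
  by case: forallP => // sx; case/eqP: s1; apply/permP=> x; rewrite perm1 (eqP (sx x)).
rewrite galg_mul_ind1; apply/ffunP=> s; rewrite !ffunE /row_stab block_stab1 !inE.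
rewrite (_ : [set x : 'I_N | val x \in _] = ~: (A :|: B)) //.
by apply/setP=> x; rewrite !inE mem_iota -eN ltn_ord /=; lia.
Qed.

Lemma theta_coefE s :
  galg_mul (galg_mul (young_symmetrizer N tla) (young_symmetrizer N [:: iota (k + l) m]))
    (young_symmetrizer N (oslash tla [:: iota 0 m])) s =
  m`!%:R * weight l A (\prod_j (point_weight A B (s (b j)) - point_weight A B (s (a j)))).
Proof.
rewrite young_row /young_symmetrizer col_sum_la col_sum_oslash.
rewrite [row_sum N tla](_ : _ = galg_ind (row_group A B)); last first.
  by rewrite /row_sum row_stab_la.
rewrite [row_sum N _](_ : _ = galg_ind (setstab B)); last first.
  by rewrite /row_sum row_stab_oslash.
set Rm := galg_ind [set s | perm_on _ s].
(* Permutations of the added row fix [B] pointwise, so their sum is absorbed by the row sum of the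
   insertion. *)
have RmK : galg_mul Rm (galg_ind (setstab B)) =
    [ffun s => m`!%:R * galg_ind (setstab B) s].
  rewrite galg_mul_subgroup => [|u]; first by rewrite cardsE card_perm card_outside.
  rewrite inE => uM v; rewrite [LHS]inE [RHS]inE imset_permM.
  have uB : u @: B = B.
    rewrite -[RHS]imset_id; apply: eq_in_imset => x xB.
    by rewrite (out_perm uM) // in_setC negbK in_setU xB orbT.
  apply/eqP/eqP => [vB|->]; last by rewrite -{1}uB imset_permK.
  by rewrite -(imset_permKV u (v @: B)) vB.
rewrite -galg_mulA [galg_mul Rm _]galg_mulA RmK galg_mulZl galg_mulZr ffunE.
by congr (_ * _); rewrite -(young_coefE aI bI aA defB dAB) !galg_mulA.
Qed.

Lemma theta_coef_gcd :
  (\big[gcdn/0%N]_(s : 'S_N) `|galg_mul (galg_mul (young_symmetrizer N tla)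
      (young_symmetrizer N [:: iota (k + l) m]))
    (young_symmetrizer N (oslash tla [:: iota 0 m])) s| *
   \big[lcmn/1%N]_(k - l + 1 <= i < (k - l + 1 + minn l m).+1) i =
   (k + 1)`! * l`! * m`!)%N.
Proof.
have := gcd_pair_weights aI bI aA defB dAB m`!; rewrite cardA card_outside => <-.
by congr (_ * _)%N; apply: eq_bigr => s _; rewrite theta_coefE.
Qed.

End TwoRowsAndOneRow.

Theorem theorem4p13 (k l m : nat) (hlk : (l <= k)%N) (hk : (1 <= k)%N)
    (hm : (1 <= m)%N) :
  (theta [:: k; l] [:: m])%:R =
    ((k + 1)`! * l`! * m`!)%N%:R /
    (\big[lcmn/1%N]_(k - l + 1 <= c < (k - l + 1 + minn l m).+1) c)%:R :> rat.
Proof.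
set L := \big[lcmn/1%N]_(_ <= c < _) c.
have thetaL : (theta [:: k; l] [:: m] * L = (k + 1)`! * l`! * m`!)%N.
  (* The degree in [theta] equals [k + l + m] only after simplifying added zeros, which is why [N]
     is a variable constrained by an equation. *)
  have eN : (sumn [:: k; l] + sumn [:: m] = k + l + m)%N by rewrite /= !addn0.
  rewrite -(theta_coef_gcd hlk hk eN); congr (_ * _)%N; apply: eq_bigr => s _.
  have tmuE : shift_tableau (sumn [:: k; l]) [:: iota 0 m] = [:: iota (k + l) m].
    by rewrite shift_tableau_row /= addn0.
  by rewrite /theta_elt std_tableau_two_rows std_tableau_row tmuE.
have L0 : (L%:R : rat) != 0.
  rewrite pnatr_eq0; apply/eqP => L0; move: thetaL; rewrite L0 muln0 => /esym/eqP.
  by rewrite !muln_eq0 !eqn0Ngt !fact_gt0.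
by rewrite -thetaL natrM mulfK.
Qed.
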